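(* Let $A\in\mathbb{Q}^{m\times n}$ be a quaternion matrix with nonzero singular values $\sigma_1\ge\sigma_2\ge\cdots\ge\sigma_r>0$, and let $X_0=\alpha A^{H}$ with $0<\alpha<\frac{2}{\sigma_1^2}$. Let $\{X_j\}_{j\ge0}$ be generated by the QSAI iteration $$X_{j+1}=X_j(I+R_j)(I+\beta_1R_j^2+R_j^4)(I+\beta_2R_j^2+R_j^4),\qquad R_j=I-AX_j,$$ where $I=I_m$, $\beta_1=\frac{1+\sqrt5}{2}$ and $\beta_2=\frac{1-\sqrt5}{2}$. Then $\{X_j\}$ converges to the Moore--Penrose inverse $A^{\dagger}$ of $A$, and for all $j\ge0$ $$\|X_{j+1}-A^{\dagger}\|\le\|A^{\dagger}\|\,\|A\|^{10}\,\|X_j-A^{\dagger}\|^{10}.$$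
   Context: $\mathbb{Q}$ denotes the skew field of real quaternions; $A^{H}=\overline{A}^{\top}$ is the conjugate transpose; singular values are those of the quaternion SVD $A=U\Sigma V^{H}$ ($U,V$ unitary quaternion matrices, $\Sigma$ real nonnegative diagonal). $\|\cdot\|$ is the operator 2-norm $\|A\|=\sup_{\|x\|_2=1}\|Ax\|_2$ with $\|x\|_2=\sqrt{x^{H}x}$. The Moore--Penrose inverse $A^{\dagger}$ is the unique $X$ with $AXA=A$, $XAX=X$, $(AX)^{H}=AX$, $(XA)^{H}=XA$. *)

(* Defs.v *)
From HB Require Import structures.
From mathcomp Require Import all_boot all_order all_algebra.
From mathcomp Require Import ring.
From mathcomp Require Import all_classical all_reals all_analysis.

Set Implicit Arguments.
Unset Strict Implicit.
Unset Printing Implicit Defensive.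

Import Order.TTheory GRing.Theory Num.Theory.
Import numFieldNormedType.Exports.

Local Open Scope classical_set_scope.
Local Open Scope ring_scope.

(* Quat a b c d is a + b i + c j + d k. *)
Record quat (R : realType) : Type :=
  Quat { qre : R; qi : R; qj : R; qk : R }.

Section QuaternionRing.
Variable R : realType.
Implicit Types x y z : quat R.

Definition tuple_of_quat x : R * R * R * R := (qre x, qi x, qj x, qk x).
Definition quat_of_tuple (t : R * R * R * R) : quat R :=
  let: (a, b, c, d) := t in Quat a b c d.

Lemma tuple_of_quatK : cancel tuple_of_quat quat_of_tuple.
Proof. by case. Qed.

HB.instance Definition _ := Choice.copy (quat R) (can_type tuple_of_quatK).

Definition add_quat x y : quat R :=
  Quat (qre x + qre y) (qi x + qi y) (qj x + qj y) (qk x + qk y).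
Definition opp_quat x : quat R := Quat (- qre x) (- qi x) (- qj x) (- qk x).

Lemma add_quatA : associative add_quat.
Proof. by move=> x y z; rewrite /add_quat /= !addrA. Qed.
Lemma add_quatC : commutative add_quat.
Proof. by move=> x y; congr Quat; rewrite addrC. Qed.
Lemma add0quat : left_id (Quat 0 0 0 0) add_quat.
Proof. by case=> a b c d; rewrite /add_quat /= !add0r. Qed.
Lemma addNquat : left_inverse (Quat 0 0 0 0) opp_quat add_quat.
Proof. by move=> x; rewrite /add_quat /= !addNr. Qed.

HB.instance Definition _ :=
  GRing.isZmodule.Build (quat R) add_quatA add_quatC add0quat addNquat.

Definition mul_quat x y : quat R :=
  Quat (qre x * qre y - qi x * qi y - qj x * qj y - qk x * qk y)
       (qre x * qi y + qi x * qre y + qj x * qk y - qk x * qj y)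
       (qre x * qj y - qi x * qk y + qj x * qre y + qk x * qi y)
       (qre x * qk y + qi x * qj y - qj x * qi y + qk x * qre y).

Lemma mul_quatA : associative mul_quat.
Proof. by move=> x y z; congr Quat => /=; ring. Qed.
Lemma mul1quat : left_id (Quat 1 0 0 0) mul_quat.
Proof. by case=> a b c d; congr Quat => /=; ring. Qed.
Lemma mul_quat1 : right_id (Quat 1 0 0 0) mul_quat.
Proof. by case=> a b c d; congr Quat => /=; ring. Qed.
Lemma mul_quatDl : left_distributive mul_quat +%R.
Proof. by move=> x y z; congr Quat => /=; ring. Qed.
Lemma mul_quatDr : right_distributive mul_quat +%R.
Proof. by move=> x y z; congr Quat => /=; ring. Qed.
Lemma one_quat_neq0 : Quat 1 0 0 0 != 0 :> quat R.
Proof. by apply/eqP => -[] /eqP; rewrite oner_eq0. Qed.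

HB.instance Definition _ :=
  GRing.Zmodule_isNzRing.Build (quat R) mul_quatA mul1quat mul_quat1 mul_quatDl mul_quatDr
    one_quat_neq0.

Definition realq (a : R) : quat R := Quat a 0 0 0.
Definition conjq x : quat R := Quat (qre x) (- qi x) (- qj x) (- qk x).

End QuaternionRing.

Definition ctrmx (R : realType) (m n : nat) (A : 'M[quat R]_(m, n)) :
  'M[quat R]_(n, m) := map_mx (@conjq R) A^T.

Notation "A ^H" := (ctrmx A) (at level 8, format "A ^H") : ring_scope.

(* x^H x is a nonnegative real quaternion, so nothing is lost in taking its
   real part. *)
Definition vnorm (R : realType) (n : nat) (x : 'cV[quat R]_n) : R :=
  Num.sqrt (qre ((x^H *m x) 0 0)).

(* sup is totalized to 0, which is used only when n = 0: otherwise the set is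
   nonempty, and it is always bounded. *)
Definition opnorm (R : realType) (m n : nat) (A : 'M[quat R]_(m, n)) : R :=
  sup [set vnorm (A *m x) | x in [set x : 'cV[quat R]_n | vnorm x = 1]].

Definition unitaryq (R : realType) (n : nat) (U : 'M[quat R]_n) : Prop :=
  U^H *m U = 1%:M /\ U *m U^H = 1%:M.

(* The entries of s on the main diagonal, padded with zeros. *)
Definition rdiag_mx (R : realType) (m n : nat) (s : seq R) :
  'M[quat R]_(m, n) :=
  \matrix_(i, j) if i == j :> nat then realq s`_i else 0.

Definition nonzero_singular_values (R : realType) (m n : nat)
    (A : 'M[quat R]_(m, n)) (s : seq R) : Prop :=
  [/\ sorted >=%R s, all (fun t => 0 < t) s, (size s <= minn m n)%N &
      exists (U : 'M[quat R]_m) (V : 'M[quat R]_n),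
        [/\ unitaryq U, unitaryq V & A = U *m rdiag_mx m n s *m V^H]].

Definition is_mpinv (R : realType) (m n : nat) (A : 'M[quat R]_(m, n))
    (X : 'M[quat R]_(n, m)) : Prop :=
  [/\ A *m X *m A = A, X *m A *m X = X,
      (A *m X)^H = A *m X & (X *m A)^H = X *m A].

(* The default value 0 is never used: a quaternion matrix always has exactly
   one Moore-Penrose inverse. *)
Definition mpinv (R : realType) (m n : nat) (A : 'M[quat R]_(m, n)) :
  'M[quat R]_(n, m) := xget 0 [set X | is_mpinv A X].

Definition beta1 (R : realType) : R := (1 + Num.sqrt 5) / 2.
Definition beta2 (R : realType) : R := (1 - Num.sqrt 5) / 2.

(* In the matrix ring, E ^+ k is the k-th power for *m. *)
Definition qsai_step (R : realType) (m n : nat) (A : 'M[quat R]_(m, n))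
    (X : 'M[quat R]_(n, m)) : 'M[quat R]_(n, m) :=
  let E : 'M[quat R]_m := 1%:M - A *m X in
  X *m (1%:M + E)
    *m (1%:M + realq (beta1 R) *: E ^+ 2 + E ^+ 4)
    *m (1%:M + realq (beta2 R) *: E ^+ 2 + E ^+ 4).

(* Main.v *)
Require Import Defs.
From mathcomp Require Import all_boot all_order all_algebra.
From mathcomp Require Import ring lra.
From mathcomp Require Import all_classical all_reals all_analysis.

Set Implicit Arguments.
Unset Strict Implicit.
Unset Printing Implicit Defensive.

Import Order.TTheory GRing.Theory Num.Theory.
Import numFieldNormedType.Exports.

Local Open Scope classical_set_scope.
Local Open Scope ring_scope.

(** Since beta1 + beta2 = 1 and beta1 * beta2 = -1, the polynomial in the QSAI
    step is 1 + E + ... + E^9 evaluated at E = I - A X ([sum_expr10_factor]),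
    so the step is the hyperpower iteration of order ten. Write G for the
    Moore-Penrose inverse of A. All iterates satisfy G A X = X = X A G: this
    holds for a multiple of A^H and is preserved by the step. Under this
    invariant the geometric sum telescopes to
      G - X_(j+1) = G (A (G - X_j))^10      ([hyperpower_step]),
    and submultiplicativity of the operator norm gives the error bound
    ([opnorm_hyperpower_step]).

    For convergence, multiplying by A shows that the residual
    T_j = A (G - X_j) satisfies T_(j+1) = T_j^10, hence T_j = T_0^(10^j), while
    G - X_j = G T_j. It remains to see that T_0 = A G - alpha A A^H has norm
    less than 1. With A = U S V^H one has G = V S' U^H, where S' inverts the
    nonzero diagonal entries of S ([is_mpinv_svd]), so T_0 is unitarily similar
    to a diagonal matrix whose nonzero entries are among the 1 - alpha t^2 for t
    a nonzero singular value; the condition on alpha makes them less than 1 in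
    absolute value ([opnorm_initial_residual_lt1]). *)

(** * Quaternions *)

Definition normsq {R : realType} (x : quat R) : R :=
  qre x ^+ 2 + qi x ^+ 2 + qj x ^+ 2 + qk x ^+ 2.

Lemma quat_ext (R : realType) (x y : quat R) :
  qre x = qre y -> qi x = qi y -> qj x = qj y -> qk x = qk y -> x = y.
Proof. by case: x y => [? ? ? ?] [? ? ? ?] /= -> -> -> ->. Qed.

Lemma realqC (R : realType) (a : R) (x : quat R) : realq a * x = x * realq a.
Proof. by apply: quat_ext => /=; ring. Qed.

Lemma realqD (R : realType) (a b : R) : realq (a + b) = realq a + realq b.
Proof. by apply: quat_ext => /=; ring. Qed.

Lemma realqN (R : realType) (a : R) : realq (- a) = - realq a.
Proof. by apply: quat_ext => /=; ring. Qed.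

Lemma realqM (R : realType) (a b : R) : realq (a * b) = realq a * realq b.
Proof. by apply: quat_ext => /=; ring. Qed.

Lemma realq1 (R : realType) : realq (1 : R) = 1.
Proof. by []. Qed.

Lemma realq0 (R : realType) : realq (0 : R) = 0.
Proof. by []. Qed.

Lemma conjqD (R : realType) (x y : quat R) : conjq (x + y) = conjq x + conjq y.
Proof. by apply: quat_ext => /=; ring. Qed.

Lemma conjq0 (R : realType) : conjq (0 : quat R) = 0.
Proof. by apply: quat_ext => /=; ring. Qed.

Lemma conjqM (R : realType) (x y : quat R) : conjq (x * y) = conjq y * conjq x.
Proof. by apply: quat_ext => /=; ring. Qed.

Lemma conjqK (R : realType) : involutive (@conjq R).
Proof. by move=> x; apply: quat_ext => /=; ring. Qed.

Lemma conjq_realq (R : realType) (a : R) : conjq (realq a) = realq a.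
Proof. by apply: quat_ext => /=; ring. Qed.

Lemma qre_sum (R : realType) (I : Type) (r : seq I) (F : I -> quat R) :
  qre (\sum_(i <- r) F i) = \sum_(i <- r) qre (F i).
Proof. by apply: (big_morph (@qre R)). Qed.

Lemma conjq_sum (R : realType) (I : Type) (r : seq I) (F : I -> quat R) :
  conjq (\sum_(i <- r) F i) = \sum_(i <- r) conjq (F i).
Proof. exact: (big_morph (@conjq R) (@conjqD R) (@conjq0 R)). Qed.

Lemma qre_conjqM (R : realType) (x : quat R) : qre (conjq x * x) = normsq x.
Proof. by rewrite /normsq /=; ring. Qed.

Lemma normsq_ge0 (R : realType) (x : quat R) : 0 <= normsq x.
Proof. by rewrite /normsq !addr_ge0 ?sqr_ge0. Qed.

Lemma normsqM (R : realType) (x y : quat R) :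
  normsq (x * y) = normsq x * normsq y.
Proof. by rewrite /normsq /=; ring. Qed.

Lemma normsq_realq (R : realType) (a : R) : normsq (realq a) = a ^+ 2.
Proof. by rewrite /normsq /=; ring. Qed.

Lemma normsq_eq0 (R : realType) (x : quat R) : normsq x = 0 -> x = 0.
Proof.
rewrite /normsq => h.
have h1 := sqr_ge0 (qre x); have h2 := sqr_ge0 (qi x).
have h3 := sqr_ge0 (qj x); have h4 := sqr_ge0 (qk x).
by apply: quat_ext; apply/eqP; rewrite -sqrf_eq0; apply/eqP; lra.
Qed.

(** The parallelogram identity: the right side exceeds the left one by
    normsq (x - y). *)
Lemma normsq_addle (R : realType) (x y : quat R) :
  normsq (x + y) <= 2 * normsq x + 2 * normsq y.
Proof.
rewrite -subr_ge0.
have -> : 2 * normsq x + 2 * normsq y - normsq (x + y) = normsq (x - y).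
  by rewrite /normsq /=; ring.
exact: normsq_ge0.
Qed.

(** A crude substitute for the Cauchy-Schwarz inequality: any constant depending
    only on the number of terms shows that matrices act as bounded operators. *)
Lemma normsq_sum_le (R : realType) (I : Type) (r : seq I) (F : I -> quat R) :
  normsq (\sum_(i <- r) F i) <= 2 ^+ size r * \sum_(i <- r) normsq (F i).
Proof.
elim: r => [|i r IH]; first by rewrite !big_nil /normsq /= expr0n /=; lra.
rewrite !big_cons /=; apply: le_trans (normsq_addle _ _) _.
have p1 : (1 : R) <= 2 ^+ size r by rewrite exprn_ege1 // ler1n.
have := normsq_ge0 (F i); move: IH; rewrite exprS; nra.
Qed.

(** * Quaternion matrices *)

Lemma ctrmxK (R : realType) (m n : nat) (A : 'M[quat R]_(m, n)) : A^H^H = A.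
Proof. by apply/matrixP => i j; rewrite !mxE conjqK. Qed.

Lemma ctrmx_mul (R : realType) (m n p : nat)
    (A : 'M[quat R]_(m, n)) (B : 'M[quat R]_(n, p)) :
  (A *m B)^H = B^H *m A^H.
Proof.
apply/matrixP => i j; rewrite !mxE conjq_sum.
by apply: eq_bigr => k _; rewrite !mxE conjqM.
Qed.

Lemma mulmx_realq (R : realType) (m n p : nat) (a : R)
    (A : 'M[quat R]_(m, n)) (B : 'M[quat R]_(n, p)) :
  A *m (realq a *: B) = realq a *: (A *m B).
Proof.
apply/matrixP => i j; rewrite !mxE big_distrr /=.
by apply: eq_bigr => k _; rewrite !mxE !mulrA realqC.
Qed.

(** * Operator norm *)

Lemma vnormE (R : realType) (n : nat) (x : 'cV[quat R]_n) :
  vnorm x = Num.sqrt (\sum_i normsq (x i 0)).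
Proof.
rewrite /vnorm !mxE qre_sum; congr Num.sqrt.
by apply: eq_bigr => i _; rewrite !mxE qre_conjqM.
Qed.

Lemma vnorm_sqr (R : realType) (n : nat) (x : 'cV[quat R]_n) :
  vnorm x ^+ 2 = \sum_i normsq (x i 0).
Proof. by rewrite vnormE sqr_sqrtr // sumr_ge0 // => i _; exact: normsq_ge0. Qed.

Lemma vnorm_ge0 (R : realType) (n : nat) (x : 'cV[quat R]_n) : 0 <= vnorm x.
Proof. exact: sqrtr_ge0. Qed.

Lemma vnorm0 (R : realType) (n : nat) : vnorm (0 : 'cV[quat R]_n) = 0.
Proof.
rewrite vnormE big1 ?sqrtr0 // => i _.
by rewrite mxE /normsq /= expr0n !addr0.
Qed.

Lemma vnorm_realq (R : realType) (n : nat) (a : R) (x : 'cV[quat R]_n) :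
  0 <= a -> vnorm (realq a *: x) = a * vnorm x.
Proof.
move=> a0; apply/eqP; rewrite -(@eqrXn2 _ 2) ?mulr_ge0 ?vnorm_ge0 // exprMn !vnorm_sqr.
rewrite big_distrr /=; apply/eqP; apply: eq_bigr => i _.
by rewrite mxE normsqM normsq_realq.
Qed.

Lemma vnorm_eq0 (R : realType) (n : nat) (x : 'cV[quat R]_n) :
  vnorm x = 0 -> x = 0.
Proof.
move=> /(congr1 (fun t => t ^+ 2)); rewrite vnorm_sqr expr0n /= => /eqP.
rewrite psumr_eq0 => [/allP h|i _]; last exact: normsq_ge0.
apply/colP => i; rewrite mxE; apply: normsq_eq0; apply/eqP.
by have := h i (mem_index_enum i).
Qed.

Lemma vnormN (R : realType) (n : nat) (x : 'cV[quat R]_n) :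
  vnorm (- x) = vnorm x.
Proof.
rewrite !vnormE; congr Num.sqrt; apply: eq_bigr => i _.
by rewrite mxE /normsq /=; ring.
Qed.

(** The supremum defining the operator norm carries information only once the
    set is known to be bounded, which is what this bound provides. *)
Lemma vnorm_mulmx_bounded (R : realType) (m n : nat) (A : 'M[quat R]_(m, n)) :
  exists2 c : R, 0 <= c & forall x, vnorm (A *m x) <= c * vnorm x.
Proof.
pose c2 : R := \sum_(i < m) 2 ^+ size (index_enum 'I_n) * \sum_(k < n) normsq (A i k).
have ge0 i : 0 <= \sum_(k < n) normsq (A i k).
  by apply: sumr_ge0 => k _; exact: normsq_ge0.
have c20 : 0 <= c2.
  by apply: sumr_ge0 => i _; rewrite mulr_ge0 // exprn_ge0.
exists (Num.sqrt c2); first exact: sqrtr_ge0.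
move=> x; rewrite -ler_sqr ?nnegrE ?mulr_ge0 ?vnorm_ge0 ?sqrtr_ge0 //.
rewrite exprMn !vnorm_sqr sqr_sqrtr // big_distrl /=; apply: ler_sum => i _.
rewrite mxE; apply: le_trans (normsq_sum_le _ _) _.
rewrite -mulrA ler_wpM2l ?exprn_ge0 // big_distrl /=; apply: ler_sum => k _.
rewrite normsqM ler_wpM2l ?normsq_ge0 // (bigD1 k) //= lerDl.
by apply: sumr_ge0 => l _; exact: normsq_ge0.
Qed.

Lemma vnorm_mulmx_has_ubound (R : realType) (m n : nat)
    (A : 'M[quat R]_(m, n)) :
  has_ubound [set vnorm (A *m x) | x in [set x : 'cV[quat R]_n | vnorm x = 1]].
Proof.
have [c _ hc] := vnorm_mulmx_bounded A.
by exists c => _ [x /= x1 <-]; rewrite -[leRHS]mulr1 -x1.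
Qed.

Lemma opnorm_ge0 (R : realType) (m n : nat) (A : 'M[quat R]_(m, n)) :
  0 <= opnorm A.
Proof.
rewrite /opnorm; set S := (X in sup X).
have [->|/set0P[_ [x x1 _]]] := eqVneq S set0; first by rewrite sup0.
apply: le_trans (vnorm_ge0 (A *m x)) _.
by apply: ub_le_sup; [exact: vnorm_mulmx_has_ubound | exists x].
Qed.

Lemma vnorm_mulmx_le (R : realType) (m n : nat) (A : 'M[quat R]_(m, n))
    (x : 'cV[quat R]_n) : vnorm (A *m x) <= opnorm A * vnorm x.
Proof.
have [/vnorm_eq0 ->|nz] := eqVneq (vnorm x) 0.
  by rewrite mulmx0 !vnorm0 mulr0.
have pos : 0 < vnorm x by rewrite lt_def nz vnorm_ge0.
rewrite -ler_pdivrMr // mulrC -vnorm_realq ?invr_ge0 ?vnorm_ge0 //.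
rewrite -mulmx_realq; apply: ub_le_sup.
  exact: vnorm_mulmx_has_ubound.
exists (realq (vnorm x)^-1 *: x) => //=.
by rewrite vnorm_realq ?invr_ge0 ?vnorm_ge0 // mulVf.
Qed.

(** The hypothesis 0 <= c covers the zero-dimensional domain, which has no unit
    vector and where the supremum is 0. *)
Lemma opnorm_le (R : realType) (m n : nat) (A : 'M[quat R]_(m, n)) (c : R) :
  0 <= c -> (forall x, vnorm (A *m x) <= c * vnorm x) -> opnorm A <= c.
Proof.
move=> c0 hc; rewrite /opnorm; set S := (X in sup X).
have [->|/set0P S0] := eqVneq S set0; first by rewrite sup0.
by apply: ge_sup => // _ [x /= x1 <-]; rewrite -[leRHS]mulr1 -x1.
Qed.

Lemma opnormM (R : realType) (m n p : nat)
    (A : 'M[quat R]_(m, n)) (B : 'M[quat R]_(n, p)) :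
  opnorm (A *m B) <= opnorm A * opnorm B.
Proof.
apply: opnorm_le => [|x]; first by rewrite mulr_ge0 ?opnorm_ge0.
rewrite -mulmxA -mulrA; apply: le_trans (vnorm_mulmx_le _ _) _.
by rewrite ler_wpM2l ?opnorm_ge0 ?vnorm_mulmx_le.
Qed.

Lemma opnormN (R : realType) (m n : nat) (A : 'M[quat R]_(m, n)) :
  opnorm (- A) = opnorm A.
Proof.
rewrite /opnorm.
suff -> : (fun x => vnorm (- A *m x)) = (fun x => vnorm (A *m x)) by [].
by apply/funext => x; rewrite mulNmx vnormN.
Qed.

Lemma opnorm_exp (R : realType) (m : nat) (A : 'M[quat R]_m) (k : nat) :
  opnorm (A ^+ k) <= opnorm A ^+ k.
Proof.
elim: k => [|k IH].
  by apply: opnorm_le => // x; rewrite !expr0 mul1mx mul1r.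
rewrite !exprS; apply: le_trans (opnormM _ _) _.
by rewrite ler_wpM2l ?opnorm_ge0.
Qed.

Lemma opnorm_unitary (R : realType) (n : nat) (U : 'M[quat R]_n) :
  U^H *m U = 1%:M -> opnorm U <= 1.
Proof.
move=> UU; apply: opnorm_le => // x.
by rewrite mul1r /vnorm ctrmx_mul -mulmxA (mulmxA _ U) UU mul1mx.
Qed.

(** * Rectangular real diagonal matrices *)

(** Writing every diagonal as the image of one sequence s turns products of
    rectangular diagonal matrices into pointwise products of functions. The
    bound on size s says that no entry of s is cut off by the inner dimension. *)
Lemma rdiag_mulmx (R : realType) (m n p : nat) (s : seq R) (f g : R -> R) :
  (size s <= n)%N ->
  rdiag_mx m n (map f s) *m rdiag_mx n p (map g s)
    = rdiag_mx m p (map (fun t => f t * g t) s).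
Proof.
move=> sn; apply/matrixP => i j; rewrite !mxE.
have [si|si] := leqP (size s) i.
  rewrite big1 => [|k _]; last first.
    by rewrite !mxE (nth_default 0 (n := i)) ?size_map // realq0 if_same mul0r.
  by rewrite nth_default ?size_map // realq0 if_same.
rewrite (bigD1 (Ordinal (leq_trans si sn))) //= big1 => [|k ki]; last first.
  rewrite !mxE; case: eqP => [e|_]; rewrite ?mul0r //.
  by case/eqP: ki; apply: val_inj.
rewrite addr0 !mxE eqxx; case: eqP => [_|_]; rewrite ?mulr0 //.
by rewrite !(nth_map 0) // realqM.
Qed.

Lemma rdiag_ctrmx (R : realType) (m n : nat) (s : seq R) :
  (rdiag_mx m n s)^H = rdiag_mx n m s.
Proof.
apply/matrixP => i j; rewrite !mxE eq_sym; case: eqP => [->|_].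
  exact: conjq_realq.
exact: conjq0.
Qed.

Lemma rdiag_sub_scale (R : realType) (m n : nat) (s : seq R) (f g : R -> R) (a : R) :
  rdiag_mx m n (map f s) - realq a *: rdiag_mx m n (map g s)
    = rdiag_mx m n (map (fun t => f t - a * g t) s).
Proof.
apply/matrixP => i j; rewrite !mxE; case: eqP => _; last by rewrite mulr0 subr0.
have [si|si] := leqP (size s) i.
  by rewrite !nth_default ?size_map // realq0 mulr0 subr0.
by rewrite !(nth_map 0) // realqD realqN realqM.
Qed.

Lemma opnorm_rdiag (R : realType) (m : nat) (s : seq R) (q : R) :
  0 <= q -> {in s, forall t, `|t| <= q} -> opnorm (rdiag_mx m m s) <= q.
Proof.
move=> q0 sq; apply: opnorm_le => // x.
rewrite -ler_sqr ?nnegrE ?mulr_ge0 ?vnorm_ge0 // exprMn !vnorm_sqr.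
rewrite big_distrr /=; apply: ler_sum => i _.
rewrite mxE (bigD1 i) //= big1 => [|l li]; last first.
  by rewrite !mxE; case: eqP => [e|_]; rewrite ?mul0r //; case/eqP: li; apply: val_inj.
rewrite addr0 !mxE eqxx normsqM normsq_realq ler_wpM2r ?normsq_ge0 //.
rewrite -real_normK ?num_real // ler_sqr ?nnegrE //.
have [si|si] := ltnP i (size s); first by apply: sq; exact: mem_nth.
by rewrite nth_default // normr0.
Qed.

(** * Moore-Penrose inverse *)

(** Both A X and A Y are self-adjoint and (A Y)(A X) = A X, so taking adjoints
    gives A X = A Y; symmetrically X A = Y A. Then X = X A X = Y A Y = Y. *)
Lemma is_mpinv_inj (R : realType) (m n : nat) (A : 'M[quat R]_(m, n))
    (X Y : 'M[quat R]_(n, m)) : is_mpinv A X -> is_mpinv A Y -> X = Y.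
Proof.
move=> [X1 X2 X3 X4] [Y1 Y2 Y3 Y4].
have AXY : A *m X = A *m Y.
  have e : A *m X = A *m Y *m (A *m X) by rewrite !mulmxA Y1.
  by rewrite -X3 e ctrmx_mul X3 Y3 !mulmxA X1.
have XAY : X *m A = Y *m A.
  have e : X *m A = X *m A *m (Y *m A) by rewrite -!mulmxA (mulmxA A) Y1.
  by rewrite -X4 e ctrmx_mul X4 Y4 -!mulmxA (mulmxA A) X1.
by rewrite -X2 XAY -mulmxA AXY mulmxA Y2.
Qed.

Lemma mpinv_eq (R : realType) (m n : nat) (A : 'M[quat R]_(m, n))
    (X : 'M[quat R]_(n, m)) : is_mpinv A X -> mpinv A = X.
Proof.
move=> AX; apply: (is_mpinv_inj (A := A)) => //.
exact: (xgetPex (P := [set Y | is_mpinv A Y]) 0 (ex_intro _ X AX)).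
Qed.

(** The inner unitary factors cancel in every product, so the four Penrose
    equations reduce to the scalar identities t t^-1 t = t and
    t^-1 t t^-1 = t^-1 on the diagonals, and to real diagonal matrices being
    self-adjoint. *)
Lemma is_mpinv_svd (R : realType) (m n : nat) (s : seq R)
    (U : 'M[quat R]_m) (V : 'M[quat R]_n) :
  unitaryq U -> unitaryq V -> (size s <= minn m n)%N -> 0 \notin s ->
  is_mpinv (U *m rdiag_mx m n s *m V^H)
    (V *m rdiag_mx n m (map GRing.inv s) *m U^H).
Proof.
move=> [UU _] [VV _]; rewrite leq_min => /andP[sm sn] s0.
have nz t : t \in s -> t != 0 by apply: contraL => /eqP ->.
set S := rdiag_mx m n s; set T := rdiag_mx n m _.
have prod p q r (P : 'M[quat R]_p) (D : 'M[quat R]_(p, q))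
      (Q : 'M[quat R]_q) (E : 'M[quat R]_(q, r)) (W : 'M[quat R]_r) :
    Q^H *m Q = 1%:M ->
    (P *m D *m Q^H) *m (Q *m E *m W^H) = P *m (D *m E) *m W^H.
  by move=> QQ; rewrite -!mulmxA (mulmxA Q^H) QQ mul1mx.
have ST : S *m T = rdiag_mx m m (map (fun t => t * t^-1) s).
  by rewrite /S -{1}(map_id s) rdiag_mulmx.
have TS : T *m S = rdiag_mx n n (map (fun t => t^-1 * t) s).
  by rewrite /S -{1}(map_id s) rdiag_mulmx.
have STS : S *m T *m S = S.
  rewrite ST /S -[X in _ *m rdiag_mx _ _ X]map_id rdiag_mulmx //.
  rewrite -[X in _ = rdiag_mx _ _ X]map_id; apply: (congr1 (rdiag_mx m n)).
  by apply/eq_in_map => t ts /=; rewrite mulfV ?nz // mul1r.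
have TST : T *m S *m T = T.
  rewrite TS /T rdiag_mulmx //; apply: (congr1 (rdiag_mx n m)).
  by apply/eq_in_map => t ts /=; rewrite mulVf ?nz // mul1r.
split.
- by rewrite (prod _ _ _ _ _ _ _ _ VV) (prod _ _ _ _ _ _ _ _ UU) STS.
- by rewrite (prod _ _ _ _ _ _ _ _ UU) (prod _ _ _ _ _ _ _ _ VV) TST.
- by rewrite (prod _ _ _ _ _ _ _ _ VV) ST !ctrmx_mul ctrmxK rdiag_ctrmx mulmxA.
- by rewrite (prod _ _ _ _ _ _ _ _ UU) TS !ctrmx_mul ctrmxK rdiag_ctrmx mulmxA.
Qed.

Lemma mpinvP (R : realType) (m n : nat) (A : 'M[quat R]_(m, n)) (s : seq R) :
  nonzero_singular_values A s -> is_mpinv A (mpinv A).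
Proof.
move=> [_ pos sz [U [V [Uu Vu ->]]]].
have s0 : 0 \notin s by apply/negP => /(allP pos); rewrite ltxx.
have svd := is_mpinv_svd Uu Vu sz s0.
by rewrite (mpinv_eq svd).
Qed.

(** * Hyperpower iterations *)

(** With u = 1 + E^4 the two quartic factors are u + P and u + Q, whose product
    is u (u + E^2) - E^4 = 1 + E^2 + E^4 + E^6 + E^8; the factor 1 + E then
    supplies the odd powers. In the application P = beta1 E^2 and
    Q = beta2 E^2, and the hypotheses express that beta1 and beta2 have sum 1
    and product -1. *)
Lemma sum_expr10_factor (S : pzRingType) (E P Q : S) :
  P + Q = E ^+ 2 -> P * Q = - E ^+ 4 -> GRing.comm P E ->
  (1 + E) * (1 + P + E ^+ 4) * (1 + Q + E ^+ 4) = \sum_(k < 10) E ^+ k.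
Proof.
move=> PDQ PMQ PE.
have -> : \sum_(k < 10) E ^+ k
    = (1 + E) * (1 + E ^+ 2 + E ^+ 4 + E ^+ 6 + E ^+ 8).
  by rewrite !big_ord_recr big_ord0 /= add0r !mulrDr mulr1 !mulrDl !mul1r -!exprS !addrA.
have expand v : P * v = v * P -> (v + P) * (v + Q) = v * (v + E ^+ 2) - E ^+ 4.
  move=> Pv; rewrite mulrDl !mulrDr Pv PMQ addrA -(addrA (v * v)) (addrC (v * Q)).
  by rewrite -[v * P + _]mulrDr PDQ.
rewrite -mulrA; congr (_ * _); rewrite (addrAC 1 P) (addrAC 1 Q) expand; last first.
  by rewrite mulrDr mulrDl mulr1 mul1r (commrX 4 PE).
rewrite !mulrDl !mulrDr !mulr1 !mul1r -!exprD.
have cancel (a b c d : S) : 1 + a + b + (a + c + d) - a = 1 + b + a + d + c.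
  rewrite -(addrA a) (addrCA _ a) (addrC a) addrK (addrC c) addrA.
  by rewrite (addrAC 1 a).
exact: cancel.
Qed.

Lemma beta_add (R : realType) : beta1 R + beta2 R = 1.
Proof. by rewrite /beta1 /beta2; field. Qed.

Lemma beta_mul (R : realType) : beta1 R * beta2 R = -1.
Proof.
have s5 : Num.sqrt (5 : R) ^+ 2 = 5 by rewrite sqr_sqrtr.
by rewrite /beta1 /beta2; field: s5.
Qed.

(** The QSAI step is a factorization of the hyperpower step of order ten, with
    fewer matrix products than the ten-term sum. *)
Lemma qsai_stepE (R : realType) (m n : nat) (A : 'M[quat R]_(m, n))
    (X : 'M[quat R]_(n, m)) :
  qsai_step A X = X *m \sum_(k < 10) (1%:M - A *m X) ^+ k.
Proof.
rewrite /qsai_step; set E := 1%:M - _.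
have scaleM a (B C : 'M[quat R]_m) : B * (realq a *: C) = realq a *: (B * C).
  exact: mulmx_realq.
have scaleMl a (B C : 'M[quat R]_m) : (realq a *: B) * C = realq a *: (B * C).
  by rewrite -!mulmxE -scalemxAl.
rewrite -(@sum_expr10_factor _ E (realq (beta1 R) *: E ^+ 2)
            (realq (beta2 R) *: E ^+ 2)).
- by rewrite -!mulmxA !mulmxE mulrA.
- by rewrite -scalerDl -realqD beta_add realq1 scale1r.
- rewrite scaleM scaleMl scalerA -realqM mulrC beta_mul realqN realq1 scaleN1r.
  by rewrite -exprD.
- by rewrite /GRing.comm scaleM scaleMl -exprS -exprSr.
Qed.

(** With E = I - A X the geometric sum telescopes: X = G (I - E), so that
    Y = G (I - E^p) and G - Y = G E^p. Inside G E^p each E may be replaced by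
    T = A (G - X) = A G - A X, the part of the residual in the range of A. This
    matters when A G differs from I: there E does not tend to 0, but T does. *)
Lemma hyperpower_step (R : realType) (m n p : nat) (A : 'M[quat R]_(m, n))
    (G X : 'M[quat R]_(n, m)) :
  A *m G *m A = A -> G *m A *m G = G ->
  G *m A *m X = X -> X *m A *m G = X ->
  let Y := X *m \sum_(k < p) (1%:M - A *m X) ^+ k in
  G - Y = G *m (A *m (G - X)) ^+ p.
Proof.
move=> AGA GAG GAX XAG /=; set E := 1%:M - _; set T := A *m (G - X).
have TE : T * E = T * T.
  rewrite /E /T -!mulmxE mulmxBr mulmx1 !mulmxBr !mulmxBl !mulmxA.
  rewrite AGA.
  have -> : A *m X *m A *m G = A *m X by rewrite -{2}XAG !mulmxA.
  by [].
have GE : G *m E = G *m T.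
  by rewrite /E /T !mulmxBr mulmx1 !mulmxA GAG.
have mulA (B C : 'M[quat R]_m) : G *m (B * C) = G *m B *m C := mulmxA G B C.
have GEk k : G *m E ^+ k = G *m T ^+ k.
  elim: k => [|k IH]; first by rewrite !expr0.
  rewrite !exprSr !mulA IH; case: k {IH} => [|k]; first by rewrite !expr0 !mulmx1.
  by rewrite exprSr -!mulA -!mulrA TE.
have XE : X = G *m (1%:M - E) by rewrite /E opprB addrC subrK mulmxA GAX.
rewrite {1}XE -mulmxA.
have -> : (1%:M - E) *m \sum_(k < p) E ^+ k = 1%:M - E ^+ p.
  by rewrite mulmxE -[LHS]opprK -mulNr opprB -subrX1 opprB.
by rewrite mulmxBr mulmx1 GEk opprB addrC subrK.
Qed.

(** Keeping the row and column spaces of X inside those of G is the invariant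
    that lets the error formula be iterated. *)
Lemma hyperpower_step_range (R : realType) (m n p : nat)
    (A : 'M[quat R]_(m, n)) (G X : 'M[quat R]_(n, m)) :
  A *m G *m A = A -> G *m A *m G = G ->
  G *m A *m X = X -> X *m A *m G = X ->
  let Y := X *m \sum_(k < p) (1%:M - A *m X) ^+ k in
  G *m A *m Y = Y /\ Y *m A *m G = Y.
Proof.
move=> AGA GAG GAX XAG Y; split; first by rewrite /Y mulmxA GAX.
have {1 2}-> : Y = G - G *m (A *m (G - X)) ^+ p.
  by rewrite -hyperpower_step // opprB addrC subrK.
set T := A *m (G - X).
have TAG : T *m (A *m G) = T.
  rewrite /T mulmxBr mulmxBl !mulmxA AGA; congr (_ - _).
  by rewrite -{2}XAG !mulmxA.
have GTAG : G *m T ^+ p *m (A *m G) = G *m T ^+ p.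
  case: (p) => [|k]; first by rewrite expr0 mulmx1 mulmxA GAG.
  by rewrite -mulmxA exprSr -mulmxE -(mulmxA _ T) TAG.
by rewrite -[LHS]mulmxA mulmxBl GTAG mulmxA GAG.
Qed.

Lemma opnorm_hyperpower_step (R : realType) (m n p : nat)
    (A : 'M[quat R]_(m, n)) (G X : 'M[quat R]_(n, m)) :
  A *m G *m A = A -> G *m A *m G = G ->
  G *m A *m X = X -> X *m A *m G = X ->
  opnorm (X *m \sum_(k < p) (1%:M - A *m X) ^+ k - G)
    <= opnorm G * opnorm A ^+ p * opnorm (X - G) ^+ p.
Proof.
move=> AGA GAG GAX XAG; rewrite -[leLHS]opnormN opprB hyperpower_step //.
apply: le_trans (opnormM _ _) _; rewrite -mulrA ler_wpM2l ?opnorm_ge0 //.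
apply: le_trans (opnorm_exp _ _) _; rewrite -exprMn.
rewrite lerXn2r ?nnegrE ?mulr_ge0 ?opnorm_ge0 //.
by rewrite -(opnormN (X - G)) opprB; exact: (opnormM A (G - X)).
Qed.

(** * The initial residual *)

Lemma opnorm_conj_unitary (R : realType) (m : nat) (U D : 'M[quat R]_m) :
  unitaryq U -> opnorm (U *m D *m U^H) <= opnorm D.
Proof.
move=> [UU UUH]; apply: le_trans (opnormM _ _) _.
have U1 := opnorm_unitary UU.
have UH1 : opnorm U^H <= 1 by apply: opnorm_unitary; rewrite ctrmxK.
have UD1 : opnorm (U *m D) <= opnorm D.
  exact: le_trans (opnormM U D) (ler_piMl (opnorm_ge0 D) U1).
exact: le_trans (ler_piMr (opnorm_ge0 _) UH1) UD1.
Qed.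

(** In the coordinates of the singular value decomposition the initial residual
    is diagonal, with entry 1 - alpha t^2 for each nonzero singular value t and
    0 elsewhere. Since 0 < t <= s_0 and alpha s_0^2 < 2, all entries lie in the
    open interval from -1 to 1. *)
Lemma opnorm_initial_residual_lt1 (R : realType) (m n : nat)
    (A : 'M[quat R]_(m, n)) (s : seq R) (alpha : R) :
  nonzero_singular_values A s -> 0 < alpha < 2 / s`_0 ^+ 2 ->
  opnorm (A *m (mpinv A - realq alpha *: A^H)) < 1.
Proof.
move=> [srt pos sz [U [V [Uu Vu ->]]]] /andP[a0 a2].
have s0 : 0 \notin s by apply/negP => /(allP pos); rewrite ltxx.
rewrite (mpinv_eq (is_mpinv_svd Uu Vu sz s0)).
set S := rdiag_mx m n s; set T := rdiag_mx n m _.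
have -> : U *m S *m V^H *m
    (V *m T *m U^H - realq alpha *: (U *m S *m V^H)^H)
  = U *m rdiag_mx m m (map (fun t => t * t^-1 - alpha * (t * t)) s) *m U^H.
  move: sz; rewrite leq_min => /andP[_ sn].
  have V1 : V^H *m V = 1%:M by case: Vu.
  have ST : S *m T = rdiag_mx m m (map (fun t => t * t^-1) s).
    by rewrite /S -{1}(map_id s) rdiag_mulmx.
  have SS : S *m rdiag_mx n m s = rdiag_mx m m (map (fun t => t * t) s).
    by rewrite /S -(map_id s) rdiag_mulmx // map_id.
  (* The entry is written t / t - alpha t^2 so that A G and A A^H are diagonal
     matrices over the same sequence s. *)
  rewrite -rdiag_sub_scale -ST -SS !ctrmx_mul ctrmxK rdiag_ctrmx.
  rewrite !mulmxBr mulmxBl !mulmx_realq -!mulmxA !(mulmxA V^H) V1 !mul1mx.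
  by rewrite -scalemxAl -!mulmxA.
apply: le_lt_trans (opnorm_conj_unitary _ Uu) _.
pose q : R := \big[Num.max/0]_(t <- s) `|t * t^-1 - alpha * (t * t)|.
have q0 : 0 <= q by apply: bigmax_ge_id.
apply: le_lt_trans (_ : q < 1).
  apply: opnorm_rdiag => // _ /mapP[t ts ->].
  exact: (le_bigmax_seq 0 t xpredT (fun t => `|t / t - alpha * (t * t)|) ts isT).
rewrite /q big_seq; apply: bigmax_lt => // t ts.
have t0 := allP pos _ ts.
have le0 : t <= s`_0.
  case: (s) srt ts => //= a l /(order_path_min ge_trans) /allP h.
  by rewrite inE => /orP[/eqP->//|/h].
have s00 : 0 < s`_0 by apply: lt_le_trans le0.
rewrite divff ?gt_eqF // ltr_norml.
move: a2; rewrite ltr_pdivlMr ?exprn_gt0 // => a2.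
have : t * t <= s`_0 ^+ 2 by rewrite expr2 ler_pM // ltW.
have : 0 < t * t by rewrite mulr_gt0.
move: (t * t) (s`_0 ^+ 2) a2 => x y a2 x0 xy.
apply/andP; split; nra.
Qed.

(** * Convergence of the iteration *)

Theorem theorem4 (R : realType) (m n : nat) (A : 'M[quat R]_(m, n))
    (sigma : seq R) (hr : (0 < size sigma)%N)
    (hsigma : nonzero_singular_values A sigma)
    (alpha : R) (halpha : 0 < alpha < 2 / sigma`_0 ^+ 2)
    (X : nat -> 'M[quat R]_(n, m))
    (hX0 : X 0%N = realq alpha *: A^H)
    (hX : forall j : nat, X j.+1 = qsai_step A (X j)) :
  (fun j : nat => opnorm (X j - mpinv A)) @ \oo --> (0 : R) /\
  (forall j : nat,
     opnorm (X j.+1 - mpinv A)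
     <= opnorm (mpinv A) * opnorm A ^+ 10 * opnorm (X j - mpinv A) ^+ 10).
Proof.
have := mpinvP hsigma.
have := opnorm_initial_residual_lt1 hsigma halpha.
move: (mpinv A) => G q1 [AGA GAG AGH GAH].
(* At j = 0 this is the identity G A A^H = A^H = A^H A G. *)
have range j : G *m A *m X j = X j /\ X j *m A *m G = X j.
  elim: j => [|j [GAX XAG]]; last first.
    by rewrite hX qsai_stepE; apply: hyperpower_step_range.
  have GAAH : G *m A *m A^H = A^H by rewrite -GAH -ctrmx_mul mulmxA AGA.
  have AHAG : A^H *m A *m G = A^H by rewrite -mulmxA -AGH -ctrmx_mul AGA.
  by rewrite hX0 mulmx_realq GAAH -!scalemxAl AHAG.
have step j : opnorm (X j.+1 - G)
    <= opnorm G * opnorm A ^+ 10 * opnorm (X j - G) ^+ 10.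
  by have [GAX XAG] := range j; rewrite hX qsai_stepE opnorm_hyperpower_step.
split=> //.
set q := opnorm _ in q1.
(* A G (A (G - X j)) = A (G - X j), so the residuals form pure powers. *)
have resid j : A *m (G - X j) = (A *m (G - X 0)) ^+ (10 ^ j).
  elim: j => [|j IH]; first by rewrite expr1.
  have [GAX XAG] := range j.
  rewrite hX qsai_stepE hyperpower_step // expnSr exprM -IH.
  have : A *m G *m (A *m (G - X j)) = A *m (G - X j).
    by rewrite !mulmxBr !mulmxA AGA.
  move: (A *m (G - X j)) => T AGT.
  have AGTB (B : 'M[quat R]_m) : A *m (G *m (T * B)) = T * B.
    by rewrite -mulmxE !mulmxA AGT.
  by rewrite exprS; apply: AGTB.
(* The exponent 10 ^ j is weakened to j, which suffices for the limit. *)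
have err j : opnorm (X j - G) <= opnorm G * q ^+ j.
  have -> : opnorm (X j - G) = opnorm (G *m (A *m (G - X j))).
    have [GAX _] := range j.
    by rewrite -opnormN opprB mulmxA mulmxBr GAG GAX.
  apply: le_trans (opnormM _ _) _; rewrite ler_wpM2l ?opnorm_ge0 // resid hX0.
  apply: le_trans (opnorm_exp _ _) _; rewrite -/q.
  by rewrite ler_wiXn2l ?opnorm_ge0 ?(ltW q1) // ltnW // ltn_expl.
have q0 : 0 <= q by exact: opnorm_ge0.
apply: (@squeeze_cvgr _ _ _ _ (fun=> 0) (fun j => opnorm G * q ^+ j)).
- by apply: nearW => j; rewrite opnorm_ge0 err.
- exact: cvg_cst.
- rewrite -(mulr0 (opnorm G)); apply: cvgMr.
  by apply: cvg_expr; rewrite ger0_norm.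
Qed.
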